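(* Let $\Delta:\mathbf{\Lambda}\to\mathbf{\Lambda}\otimes\mathbf{\Lambda}$ be the coproduct on the ring $\mathbf{\Lambda}$ of symmetric functions in superspace. Then for every integer $i\ge 1$ (respectively $i\geq 0$ for the formulas involving tildes), $$\Delta e_i=\sum_{k+\ell=i} e_k\otimes e_\ell,\qquad \Delta\tilde e_i=\sum_{k+\ell=i}\left(\tilde e_k\otimes e_\ell+e_\ell\otimes\tilde e_k\right),$$ and $$\Delta h_i=\sum_{k+\ell=i} h_k\otimes h_\ell,\qquad \Delta\tilde h_i=\sum_{k+\ell=i}\left(\tilde h_k\otimes h_\ell+h_\ell\otimes\tilde h_k\right),$$ where all sums are over pairs of non-negative integers $(k,\ell)$.
   Context: Let $x_1,x_2,\dots$ be commuting variables and $\theta_1,\theta_2,\dots$ anticommuting variables ($\theta_i\theta_j=-\theta_j\theta_i$, $\theta_i^2=0$), the $x$'s commuting with the $\theta$'s. The ring $\mathbf{\Lambda}$ of symmetric functions in superspace is the ring of formal power series over $\mathbb Q$ of bounded degree in these variables that are invariant under simultaneous permutation of the pairs $(x_i,\theta_i)$. The fermionic degree is the degree in the $\theta$'s. A superpartition is a pair $\Lambda=(\Lambda^a;\Lambda^s)=(\Lambda_1,\dots,\Lambda_m;\Lambda_{m+1},\dots,\Lambda_N)$, where $\Lambda^a$ is a strictly decreasing sequence of $m$ non-negative integers and $\Lambda^s$ is a partition (trailing zeros are irrelevant). It is of type $(n|m)$ if $\sum_i\Lambda_i=n$ and $\Lambda^a$ has $m$ parts. The monomial symmetric function $m_\Lambda$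 is the sum of the distinct terms among $\theta_{\sigma(1)}\cdots\theta_{\sigma(m)}x_{\sigma(1)}^{\Lambda_1}\cdots x_{\sigma(N)}^{\Lambda_N}$ over permutations $\sigma\in S_N$ (with $\Lambda$ padded by zeros to length $N$), taken in the limit of infinitely many variables $N\to\infty$. For $r\ge1$ and $k\ge0$: $e_r=m_{(\emptyset;1^r)}$, $\tilde e_k=m_{(0;1^k)}$, $h_r=\sum_{\Lambda}m_\Lambda$ over superpartitions $\Lambda$ of type $(r|0)$, and $\tilde h_k=\sum_{\Lambda}(\Lambda_1+1)m_\Lambda$ over superpartitions $\Lambda$ of type $(k|1)$ (here $\Lambda_1$ is the unique part of $\Lambda^a$). Also $e_0=h_0=1$. $\mathbf{\Lambda}\otimes\mathbf{\Lambda}$ (over $\mathbb Q$) is identified with functions of two sets of variables $(x;\theta)$ and $(y;\phi)$, symmetric in each set separately, with the $\theta$'s and $\phi$'s anticommuting with each other; $f\otimes g$ corresponds to $f(x;\theta)g(y;\phi)$. Thus $(f_1\otimes g_1)(f_2\otimes g_2)=(-1)^{ab}f_1f_2\otimes g_1g_2$ when $g_1,f_2$ have fermionic degrees $a,b$. The coproduct is $(\Delta f)(x,y;\theta,\phi)=f(x,y;\theta,\phi)$, i.e. $f$ evaluated on the union of the two sets of variables. *)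

(* Defs.v *)
From HB Require Import structures.
From mathcomp Require Import all_boot all_order all_algebra.
From mathcomp Require Import finmap multiset ring.
From mathcomp Require Import boolp classical_sets functions cardinality fsbigop.
Set Implicit Arguments.
Unset Strict Implicit.
Unset Printing Implicit Defensive.
Import Order.TTheory GRing.Theory.
Local Open Scope ring_scope.
Local Open Scope classical_set_scope.
Local Open Scope fset_scope.
Local Open Scope mset_scope.
Local Open Scope ring_scope.

(* A pair (b, J) stands for the monomial x^b theta_J, where the exponent of x_v
   is the multiplicity of v in the multiset b, and theta_J is the product of the
   theta_v, v \in J, taken in increasing order. *)
Definition smon (V : choiceType) : Type := ({mset V} * {fset V})%type.
HB.instance Definition _ (V : choiceType) := Choice.on (smon V).

Definition sdeg (V : choiceType) (m : smon V) : nat := (size m.1 + #|` m.2|)%N.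

(* A formal power series in the x_v and theta_v, given by its coefficients in
   the basis of monomials x^b theta_J. *)
Definition series (V : choiceType) : Type := smon V -> rat.
HB.instance Definition _ (V : choiceType) := Choice.on (series V).
HB.instance Definition _ (V : choiceType) := GRing.Zmodule.on (series V).

Section Superspace.
Context {d : Order.disp_t} {V : orderType d}.
Implicit Types (w : seq V) (b : {mset V}) (J : {fset V}).

Fixpoint inversions w : nat :=
  if w is v :: w' then (count (fun u => u < v)%O w' + inversions w')%N else 0%N.

Definition increasing J : seq V := sort <=%O J.

(* The element x^b theta_{w_1} ... theta_{w_k}, the factors theta being in the
   order of w: it vanishes if w has a repetition, and otherwise sorting w
   contributes a sign. *)
Definition monomial b w : series V := fun m =>
  if uniq w && (m == (b, [fset v in w]%fset)) then (-1) ^+ inversions w else 0.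

(* In this sum, as in the one defining [subst], only finitely many terms
   contribute to a given coefficient (for [subst], when sigma is injective). *)
Definition smul (f g : series V) : series V := fun m =>
  \sum_(p \in [set: smon V * smon V])
    f p.1 * g p.2 *
    monomial (p.1.1 `+` p.2.1)%mset (increasing p.1.2 ++ increasing p.2.2) m.

Definition bounded_degree (f : series V) : Prop :=
  exists k : nat, forall m, f m != 0 -> (sdeg m <= k)%N.

Definition sone : series V := monomial mset0 [::].

End Superspace.

(* The series obtained from f by the simultaneous substitution
   x_v |-> x_{sigma v}, theta_v |-> theta_{sigma v}. *)
Definition subst {d d' : Order.disp_t} {V : orderType d} {W : orderType d'}
    (sigma : V -> W) (f : series V) : series W := fun m =>
  \sum_(n \in [set: smon V])
    f n * monomial (seq_mset [seq sigma v | v <- n.1])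
                   [seq sigma v | v <- increasing n.2] m.

Section Signs.
Context {d : Order.disp_t} {V : orderType d}.
Implicit Types (w : seq V) (b : {mset V}) (J : {fset V}).

Definition sgn w : rat := (-1) ^+ inversions w.

Fixpoint pairsum (s : V -> V -> nat) w : nat :=
  if w is v :: w' then (\sum_(u <- w') s v u + pairsum s w')%N else 0%N.

Lemma pairsum_double s w : (forall x y, s x y = s y x) ->
  ((pairsum s w).*2 + \sum_(x <- w) s x x =
   \sum_(x <- w) \sum_(y <- w) s x y)%N.
Proof.
move=> ssym; elim: w => [|v w IH] /=; first by rewrite !big_nil.
rewrite !big_cons.
under [X in _ = (_ + X)%N]eq_bigr do rewrite big_cons.
rewrite big_split /= -IH (eq_bigr (fun u => s u v)) => [|i _]; last exact: ssym.
by rewrite doubleD -addnn; ring.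
Qed.

Lemma pairsum_perm s w w' : (forall x y, s x y = s y x) -> perm_eq w w' ->
  pairsum s w = pairsum s w'.
Proof.
move=> ssym ww'; apply: double_inj.
apply: (@addIn (\sum_(x <- w) s x x)%N).
rewrite pairsum_double // [in RHS](perm_big _ ww') /= pairsum_double //.
by rewrite (perm_big _ ww') /=; apply: eq_bigr => i _; apply: perm_big.
Qed.

Lemma inversions_cat w w' : inversions (w ++ w') =
  (inversions w + inversions w' + \sum_(v <- w) count (fun u => u < v)%O w')%N.
Proof.
elim: w => [|v w IH] /=; first by rewrite big_nil addn0.
by rewrite big_cons count_cat IH; ring.
Qed.

Lemma inversions_increasing J : inversions (increasing J) = 0%N.
Proof.
rewrite /increasing; have := sort_le_sorted (enum_fset J).
elim: (sort _ _) => //= v w IH vw.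
rewrite IH ?(path_sorted vw) // addn0; apply/eqP; rewrite -leqn0 leqNgt -has_count.
apply/hasPn => u uw; rewrite -leNgt.
by move: vw; rewrite (path_sortedE le_trans) => /andP[/allP/(_ _ uw)].
Qed.

Lemma sgn_increasing J : sgn (increasing J) = 1.
Proof. by rewrite /sgn inversions_increasing. Qed.

Lemma perm_increasing J : perm_eq (increasing J) J.
Proof. by rewrite /increasing perm_sort. Qed.

Lemma sgn_sqr w : sgn w * sgn w = 1.
Proof. by rewrite /sgn -expr2 sqrr_sign. Qed.

Lemma sgn_neq0 w : sgn w != 0.
Proof. by rewrite /sgn signr_eq0. Qed.

Lemma in_fseq w v : (v \in [fset v in w]) = (v \in w).
Proof. by rewrite inE. Qed.

Lemma monomial_cat_perm b u u' v v' : perm_eq u u' -> perm_eq v v' ->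
  forall m, monomial b (u ++ v) m * (sgn u * sgn v) =
            monomial b (u' ++ v') m * (sgn u' * sgn v').
Proof.
move=> uu' vv' m; rewrite /monomial.
have pc : perm_eq (u ++ v) (u' ++ v') by apply: perm_cat.
rewrite (perm_uniq pc).
have -> : [fset x in u ++ v] = [fset x in u' ++ v'].
  by apply/fsetP => x; rewrite !in_fseq (perm_mem pc).
case: ifP => _; last by rewrite !mul0r.
rewrite !inversions_cat !exprD -!/(sgn _).
have -> : (\sum_(x <- u) count (fun y => y < x)%O v =
           \sum_(x <- u') count (fun y => y < x)%O v')%N.
  by rewrite (perm_big _ uu'); apply: eq_bigr => x _; apply/permP.
by rewrite [LHS]mulrAC [RHS]mulrAC mulrACA [in RHS]mulrACA !sgn_sqr.
Qed.

Lemma monomial_neq0 b w m : monomial b w m != 0 ->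
  uniq w /\ m = (b, [fset v in w]).
Proof. by rewrite /monomial; case: ifP; rewrite ?eqxx // => /andP[-> /eqP]. Qed.

End Signs.

Lemma sgn_map {d d' : Order.disp_t} {V : orderType d} {W : orderType d'}
    (g : V -> W) (u v : seq V) : injective g -> perm_eq u v ->
  sgn (map g u) * sgn u = sgn (map g v) * sgn v.
Proof.
move=> ginj uv.
pose s x y : nat := (y < x)%O (+) (g y < g x)%O.
have ssym x y : s x y = s y x.
  rewrite /s; case: (ltgtP x y) => [xy|xy|->] //; case: (ltgtP (g x) (g y)) => //.
  - by move/ginj => e; rewrite e ltxx in xy.
  - by move/ginj => e; rewrite e ltxx in xy.
suff key w : sgn (map g w) * sgn w = (-1) ^+ pairsum s w.
  by rewrite !key (pairsum_perm ssym uv).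
elim: w => [|x w IH] /=; first by rewrite /sgn expr0 mulr1.
rewrite /sgn /= !exprD mulrACA -!/(sgn _) IH; congr (_ * _).
elim: w {IH} => [|y w IH] /=; first by rewrite big_nil expr0 mulr1.
by rewrite big_cons !exprD mulrACA IH /s signr_addb mulrC [(-1) ^+ _ * _ in RHS]mulrC mulrC.
Qed.

Section Substitution.
Context {d d' : Order.disp_t} {V : orderType d} {W : orderType d'}.
Variable sigma : V -> W.
Hypothesis sigmaI : injective sigma.

Definition mset_map (b : {mset V}) : {mset W} :=
  seq_mset [seq sigma v | v <- b].

Definition smon_map (n : smon V) : smon W :=
  (mset_map n.1, [fset sigma v | v in n.2]).

Definition smon_sgn (n : smon V) : rat := sgn [seq sigma v | v <- increasing n.2].

Lemma mset_mapE b v : mset_map b (sigma v) = b v.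
Proof.
rewrite mset_seqE count_map -[RHS]count_mem_mset; apply: eq_count => u /=.
by rewrite (inj_eq sigmaI).
Qed.

Lemma mset_map_inj : injective mset_map.
Proof. by move=> b c bc; apply/msetP => v; rewrite -!mset_mapE bc. Qed.

Lemma smon_map_inj : injective smon_map.
Proof.
move=> [b J] [c K] [/mset_map_inj -> JK]; congr (_, _).
apply/fsetP => v; move/fsetP/(_ (sigma v)): JK.
by rewrite !(mem_imfset _ _ sigmaI).
Qed.

Lemma fset_map (w : seq V) :
  [fset u in [seq sigma v | v <- w]] = [fset sigma v | v in [fset v in w]].
Proof.
apply/fsetP => u; rewrite !inE; apply/mapP/imfsetP => /= -[v vw ->].
  by exists v => //; rewrite inE.
by exists v => //; move: vw; rewrite inE.
Qed.

Lemma monomial_map b w n :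
  monomial (mset_map b) [seq sigma v | v <- w] (smon_map n) =
  smon_sgn n * monomial b w n.
Proof.
rewrite /monomial map_inj_uniq // fset_map -[(mset_map b, _)]/(smon_map (b, _)).
rewrite (inj_eq smon_map_inj); case: ifP => [/andP[wu /eqP ->]|]; last by rewrite mulr0.
have pw : perm_eq (increasing [fset v in w]) w.
  apply: perm_trans (perm_increasing _) _; apply: uniq_perm => [|//|x]; first exact: fset_uniq.
  exact: in_fseq.
rewrite /smon_sgn -/(sgn _) -/(sgn _).
have := sgn_map sigmaI pw; rewrite sgn_increasing mulr1 => /= ->.
by rewrite -mulrA sgn_sqr mulr1.
Qed.

Lemma monomial_map0 b w m : ~ range smon_map m ->
  monomial (mset_map b) [seq sigma v | v <- w] m = 0.
Proof.
move=> Hm; apply/eqP/negPn/negP => /monomial_neq0[_ mE]; apply: Hm.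
by exists (b, [fset v in w]); rewrite // mE fset_map.
Qed.

Lemma substE f n : subst sigma f (smon_map n) = smon_sgn n * f n.
Proof.
rewrite /subst -(@fsbig_widen _ _ _ _ [set n]) //; last first.
  move=> k [_ /= kn]; rewrite monomial_map /monomial.
  case: ifP => [/andP[_ /eqP nE]|]; last by rewrite !mulr0.
  case: kn; rewrite nE; case: k nE => k K /= _; congr (_, _).
  by apply/fsetP => x; rewrite in_fseq (perm_mem (perm_increasing _)).
rewrite fsbig_set1 monomial_map mulrC -mulrA; congr (_ * _).
rewrite /monomial (perm_uniq (perm_increasing _)) fset_uniq /=.
have -> : [fset v in increasing n.2] = n.2.
  by apply/fsetP => x; rewrite in_fseq (perm_mem (perm_increasing _)).
by rewrite -surjective_pairing eqxx -/(sgn _) sgn_increasing mul1r.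
Qed.

Lemma subst_out f m : ~ range smon_map m -> subst sigma f m = 0.
Proof. by move=> Hm; apply: fsbig1 => n _; rewrite monomial_map0 // mulr0. Qed.

Lemma smon_sgn_neq0 n : smon_sgn n != 0. Proof. exact: sgn_neq0. Qed.

Lemma subst_inj : injective (subst sigma).
Proof.
move=> f g fg; apply/funext => n; apply: (mulfI (smon_sgn_neq0 n)).
by rewrite -!substE fg.
Qed.

Lemma substB : {morph subst sigma : f g / f - g}.
Proof.
move=> f g; apply/funext => m.
rewrite -[(_ - _) m]/(subst sigma f m - subst sigma g m).
case: (pselect (range smon_map m)) => [[n _ <-]|Hm].
  by rewrite !substE mulrBr.
by rewrite !subst_out // subr0.
Qed.

Lemma subst0 : subst sigma 0 = 0.
Proof. by rewrite -(subrr 0) substB subrr. Qed.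

Lemma subst_monomial b w :
  subst sigma (monomial b w) = monomial (mset_map b) [seq sigma v | v <- w].
Proof.
apply/funext => m; case: (pselect (range smon_map m)) => [[n _ <-]|Hm].
  by rewrite substE monomial_map.
by rewrite subst_out // monomial_map0.
Qed.

Lemma mset_mapD b c : mset_map (b `+` c) = (mset_map b `+` mset_map c)%mset.
Proof.
apply/msetP => w; rewrite msetE2 !mset_seqE -count_cat -map_cat.
apply/permP/perm_map/allP => x _ /=.
by rewrite count_cat !count_mem_mset msetE2.
Qed.

Lemma perm_increasing_map (J : {fset V}) :
  perm_eq (increasing [fset sigma v | v in J])
          [seq sigma v | v <- increasing J].
Proof.
apply: perm_trans (perm_increasing _) _; apply: uniq_perm; first exact: fset_uniq.
  by rewrite map_inj_uniq // (perm_uniq (perm_increasing _)) fset_uniq.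
move=> x; apply/imfsetP/mapP => -[v /= vJ ->]; exists v => //=.
  by rewrite (perm_mem (perm_increasing _)).
by rewrite -(perm_mem (perm_increasing _)).
Qed.

Lemma subst_smul f g :
  subst sigma (smul f g) = smul (subst sigma f) (subst sigma g).
Proof.
have mapE (p : smon V * smon V) m :
  subst sigma f (smon_map p.1) * subst sigma g (smon_map p.2) *
    monomial ((smon_map p.1).1 `+` (smon_map p.2).1)%mset
      (increasing (smon_map p.1).2 ++ increasing (smon_map p.2).2) m =
  f p.1 * g p.2 * monomial (mset_map (p.1.1 `+` p.2.1))
      [seq sigma v | v <- increasing p.1.2 ++ increasing p.2.2] m.
  rewrite !substE mulrACA [_ * (f _ * _)]mulrC -[LHS]mulrA; congr (_ * _).
  rewrite mset_mapD map_cat mulrC.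
  have := monomial_cat_perm (mset_map p.1.1 `+` mset_map p.2.1)%mset
     (perm_increasing_map p.1.2) (perm_increasing_map p.2.2) m.
  rewrite !sgn_increasing !mulr1 => ->.
  by rewrite -mulrA mulrACA !sgn_sqr !mulr1.
apply/funext => m; rewrite [RHS]/smul.
pose h (p : smon V * smon V) := (smon_map p.1, smon_map p.2).
rewrite -(@fsbig_widen _ _ _ _ (range h)) //; last first.
  move=> [p q] [_ /= Hpq].
  case: (pselect (range smon_map p)) => [[p' _ pE]|Hp]; last first.
    by rewrite (subst_out _ Hp) !mul0r.
  case: (pselect (range smon_map q)) => [[q' _ qE]|Hq]; last first.
    by rewrite (subst_out _ Hq) mulr0 mul0r.
  by case: Hpq; exists (p', q') => //; rewrite /h pE qE.
have hI : injective h.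
  move=> [p q] [p' q'] e.
  by move: (smon_map_inj (congr1 fst e)) (smon_map_inj (congr1 snd e)) => /= -> ->.
rewrite fsbig_image; last by move=> x y _ _; apply: hI.
under eq_fsbigr => p _ do rewrite mapE.
case: (pselect (range smon_map m)) => [[n _ <-]|Hm].
  rewrite substE mulr_fsumr; apply: eq_fsbigr => p _.
  by rewrite monomial_map mulrCA.
by rewrite subst_out // fsbig1 // => p _; rewrite monomial_map0 // mulr0.
Qed.

End Substitution.

Lemma subst_comp {d d' d'' : Order.disp_t} {U : orderType d} {V : orderType d'}
    {W : orderType d''} (tau : V -> W) (sigma : U -> V) f :
  injective tau -> injective sigma ->
  subst tau (subst sigma f) = subst (tau \o sigma) f.
Proof.
move=> tI sI; have tsI : injective (tau \o sigma) by apply: inj_comp.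
have smap n : smon_map tau (smon_map sigma n) = smon_map (tau \o sigma) n.
  congr (_, _).
    apply/eq_seq_msetP.
    have := perm_map tau (perm_eq_seq_mset [seq sigma v | v <- n.1]).
    by rewrite -map_comp.
  apply/fsetP => w; apply/imfsetP/imfsetP => /=.
    by move=> [v /imfsetP[/= u uJ ->] ->]; exists u.
  by move=> [u uJ ->]; exists (sigma u) => //; apply/imfsetP; exists u.
apply/funext => m; case: (pselect (range (smon_map tau) m)) => [[n _ <-]|Hm].
  case: (pselect (range (smon_map sigma) n)) => [[k _ <-]|Hn].
    rewrite !substE // smap substE // mulrA; congr (_ * _).
    have := sgn_map tI (perm_increasing_map sI k.2).
    rewrite sgn_increasing mulr1 -map_comp /smon_sgn /= => ->.
    by rewrite -mulrA sgn_sqr mulr1.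
  rewrite substE // subst_out // mulr0 subst_out // => -[k _].
  rewrite -smap => /(smon_map_inj tI) kn; apply: Hn.
  by exists k.
rewrite !subst_out // => -[k _ kE]; apply: Hm; exists (smon_map sigma k) => //.
by rewrite smap.
Qed.

Section Bounded.
Context {d d' : Order.disp_t} {V : orderType d} {W : orderType d'}.

Lemma size_msetD (b c : {mset V}) : size (b `+` c)%mset = (size b + size c)%N.
Proof.
rewrite -size_cat; apply/perm_size/allP => x _ /=.
by rewrite count_cat !count_mem_mset msetE2.
Qed.

Lemma card_fseq_le (w : seq V) : (#|` [fset v in w]%fset| <= size w)%N.
Proof. by rewrite card_fseq size_undup. Qed.

Lemma size_increasing (J : {fset V}) : size (increasing J) = #|` J|.
Proof. by rewrite (perm_size (perm_increasing _)). Qed.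

Lemma bounded_monomial b (w : seq V) : bounded_degree (monomial b w).
Proof.
exists (size b + size w)%N => m /monomial_neq0[_ ->].
by rewrite /sdeg leq_add2l card_fseq_le.
Qed.

Lemma fsum_neq0 (T : choiceType) (A : set T) (F : T -> rat) :
  \sum_(x \in A) F x != 0 -> exists2 x, A x & F x != 0.
Proof. exact: (@fsbigN1 _ _ _ unit T A (fun=> F) tt). Qed.

Lemma bounded_smul (f g : series V) :
  bounded_degree f -> bounded_degree g -> bounded_degree (smul f g).
Proof.
move=> [k fk] [l gl]; exists (k + l)%N => m.
move=> /fsum_neq0[p _]; rewrite !mulf_eq0 !negb_or -andbA.
move=> /and3P[/fk pk /gl pl /monomial_neq0[_ ->]]; rewrite /sdeg /= size_msetD.
apply: leq_trans (leq_add pk pl); rewrite /sdeg addnACA leq_add2l.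
by apply: leq_trans (card_fseq_le _) _; rewrite size_cat !size_increasing.
Qed.

Lemma bounded_subst (sigma : V -> W) f : injective sigma ->
  bounded_degree f -> bounded_degree (subst sigma f).
Proof.
move=> sI [k fk]; exists k => m.
case: (pselect (range (smon_map sigma) m)) => [[n _ <-]|Hm]; last first.
  by rewrite subst_out // eqxx.
rewrite substE // mulf_eq0 negb_or => /andP[_ /fk]; apply: leq_trans.
rewrite /sdeg /= (perm_size (perm_eq_seq_mset _)) size_map leq_add2l.
exact: leq_imfset_card.
Qed.

Lemma boundedB (f g : series V) :
  bounded_degree f -> bounded_degree g -> bounded_degree (f - g).
Proof.
move=> [k fk] [l gl]; exists (maxn k l) => m.
rewrite leq_max => fg; apply/orP.
have [f0|/fk ->] := eqVneq (f m) 0; last by left.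
have [g0|/gl ->] := eqVneq (g m) 0; last by right.
by move: fg; rewrite -[(f - g) m]/(f m - g m) f0 g0 subrr eqxx.
Qed.

Lemma bounded0 : bounded_degree (0 : series V).
Proof. by exists 0%N => m /eqP. Qed.

End Bounded.

(* The variables are x_0, x_1, ... and theta_0, theta_1, ... *)
Definition symmetric_series (f : series nat) : Prop :=
  forall s : nat -> nat, bijective s -> subst s f = f.

Definition Lambda_pred : {pred series nat} :=
  fun f => `[< symmetric_series f /\ bounded_degree f >].

Lemma Lambda_zmod_closed : zmod_closed Lambda_pred.
Proof.
split=> [|f g]; rewrite ?unfold_in.
  apply/asboolP; split; last exact: bounded0.
  by move=> s /bij_inj sI; rewrite subst0.
move=> /asboolP[fs fb] /asboolP[gs gb]; apply/asboolP; split.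
  by move=> s sb; rewrite substB ?fs ?gs //; exact: bij_inj.
exact: boundedB.
Qed.
HB.instance Definition _ :=
  GRing.isZmodClosed.Build (series nat) Lambda_pred Lambda_zmod_closed.

Record Lambda := MkLambda { lseries :> series nat; _ : lseries \in Lambda_pred }.
HB.instance Definition _ := [isSub for lseries].
HB.instance Definition _ := [Choice of Lambda by <:].
HB.instance Definition _ := [SubChoice_isSubZmodule of Lambda by <:].

(* Lambda (x) Lambda is realized as functions of the two alphabets
   x_i = x_(false, i), theta_i = theta_(false, i) and y_i = x_(true, i),
   phi_i = theta_(true, i); the lexicographic order puts the theta's before
   the phi's. *)
Definition var2 : orderType _ := (bool *l nat)%type.
Definition varx (i : nat) : var2 := (false, i).
Definition vary (i : nat) : var2 := (true, i).

Definition perm2 (s t : nat -> nat) (v : var2) : var2 :=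
  if v.1 then vary (t v.2) else varx (s v.2).

Definition bisymmetric_series (F : series var2) : Prop :=
  forall s t : nat -> nat, bijective s -> bijective t -> subst (perm2 s t) F = F.

Definition Lambda2_pred : {pred series var2} :=
  fun F => `[< bisymmetric_series F /\ bounded_degree F >].

Lemma varx_inj : injective varx. Proof. by move=> i j []. Qed.
Lemma vary_inj : injective vary. Proof. by move=> i j []. Qed.

Lemma perm2_bij s t : bijective s -> bijective t -> bijective (perm2 s t).
Proof.
move=> [s' sK s'K] [t' tK t'K]; exists (perm2 s' t') => -[[] i];
  by rewrite /perm2 /= ?sK ?s'K ?tK ?t'K.
Qed.

Lemma Lambda2_zmod_closed : zmod_closed Lambda2_pred.
Proof.
split=> [|f g]; rewrite ?unfold_in.
  apply/asboolP; split; last exact: bounded0.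
  by move=> s t sb tb; rewrite subst0 //; apply/bij_inj/perm2_bij.
move=> /asboolP[fs fb] /asboolP[gs gb]; apply/asboolP; split.
  by move=> s t sb tb; rewrite substB ?fs ?gs //; apply/bij_inj/perm2_bij.
exact: boundedB.
Qed.
HB.instance Definition _ :=
  GRing.isZmodClosed.Build (series var2) Lambda2_pred Lambda2_zmod_closed.

Record Lambda2 := MkLambda2 { lseries2 :> series var2; _ : lseries2 \in Lambda2_pred }.
HB.instance Definition _ := [isSub for lseries2].
HB.instance Definition _ := [Choice of Lambda2 by <:].
HB.instance Definition _ := [SubChoice_isSubZmodule of Lambda2 by <:].

Lemma LambdaP (f : Lambda) : symmetric_series f /\ bounded_degree f.
Proof. by case: f => f /= /asboolP. Qed.

Lemma Lambda_smul (f g : Lambda) : smul f g \in Lambda_pred.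
Proof.
have [fs fb] := LambdaP f; have [gs gb] := LambdaP g.
apply/asboolP; split; last exact: bounded_smul.
by move=> s sb; rewrite subst_smul ?fs ?gs //; exact: bij_inj.
Qed.

(* f (x) g is the product f(x; theta) g(y; phi). *)
Definition tensor_series (f g : series nat) : series var2 :=
  smul (subst varx f) (subst vary g).

Lemma tensor_subproof (f g : Lambda) : tensor_series f g \in Lambda2_pred.
Proof.
have [fs fb] := LambdaP f; have [gs gb] := LambdaP g.
apply/asboolP; split; last first.
  by apply: bounded_smul; apply: bounded_subst => //; [exact: varx_inj|exact: vary_inj].
move=> s t sb tb; have pI := bij_inj (perm2_bij sb tb).
rewrite /tensor_series subst_smul // !subst_comp //; try exact: varx_inj;
  try exact: vary_inj.
rewrite -[_ \o varx]/(varx \o s) -[_ \o vary]/(vary \o t).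
rewrite -(@subst_comp _ _ _ _ _ _ _ _ _ varx_inj (bij_inj sb)) fs //.
by rewrite -(@subst_comp _ _ _ _ _ _ _ _ _ vary_inj (bij_inj tb)) gs.
Qed.
Definition tensor (f g : Lambda) : Lambda2 := MkLambda2 (tensor_subproof f g).

(* The evaluation of f on the union of the two alphabets: the variables
   z_0, z_1, z_2, ... of f are replaced by x_0, y_0, x_1, y_1, ...; by symmetry
   of f any other enumeration of the union gives the same result, see
   [Delta_indep]. *)
Definition interleave (n : nat) : var2 := if odd n then vary n./2 else varx n./2.

Definition Delta_series (f : series nat) : series var2 := subst interleave f.

Lemma interleave_bij : bijective interleave.
Proof.
exists (fun v : var2 => nat_of_bool v.1 + v.2.*2)%N => [n|[[] i]]; rewrite /interleave.
- by case: ifP => on /=; rewrite -[RHS]odd_double_half on.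
- by rewrite oddD odd_double /= uphalf_double.
- by rewrite add0n odd_double doubleK.
Qed.

Lemma Delta_indep (f : Lambda) (s : nat -> var2) : bijective s ->
  subst s f = Delta_series f.
Proof.
move=> sb; have [u uK Ku] := interleave_bij; have [fs _] := LambdaP f.
have usb : bijective (u \o s).
  by apply: bij_comp => //; exists interleave.
rewrite -[in RHS](fs _ usb) /Delta_series.
rewrite (subst_comp _ (can_inj uK) (bij_inj usb)).
have -> // : interleave \o (u \o s) = s.
by apply/funext => n; exact: Ku.
Qed.

Lemma Delta_subproof (f : Lambda) : Delta_series f \in Lambda2_pred.
Proof.
apply/asboolP; split; last first.
  by apply: bounded_subst; [exact: bij_inj interleave_bij|case: (LambdaP f)].
move=> s t sb tb; have pb := perm2_bij sb tb.
rewrite subst_comp; [|exact: bij_inj|exact: bij_inj interleave_bij].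
by apply: Delta_indep; apply: bij_comp => //; exact: interleave_bij.
Qed.
Definition Delta (f : Lambda) : Lambda2 := MkLambda2 (Delta_subproof f).

(* The pair (Lambda^a, Lambda^s); trailing zeros being irrelevant, Lambda^s is
   required to have no zero part. *)
Definition is_superpartition (L : seq nat * seq nat) : bool :=
  [&& sorted gtn L.1, sorted geq L.2 & 0%N \notin L.2].
Definition superpartition : Type := {L : seq nat * seq nat | is_superpartition L}.
HB.instance Definition _ := Choice.on superpartition.

Definition fermionic (L : superpartition) : seq nat := (val L).1.
Definition bosonic (L : superpartition) : seq nat := (val L).2.
Definition parts (L : superpartition) : seq nat := fermionic L ++ bosonic L.
Definition of_type (n m : nat) (L : superpartition) : Prop :=
  sumn (parts L) = n /\ size (fermionic L) = m.

Lemma leq_sumn (l : seq nat) i : i \in l -> (i <= sumn l)%N.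
Proof.
elim: l => //= j l IH; rewrite inE => /orP[/eqP ->|/IH il]; first exact: leq_addr.
exact: leq_trans il (leq_addl _ _).
Qed.

Lemma size_leq_sumn (l : seq nat) : 0%N \notin l -> (size l <= sumn l)%N.
Proof.
elim: l => //= j l IH; rewrite inE negb_or => /andP[j0 /IH l0].
by rewrite -add1n leq_add // lt0n eq_sym.
Qed.

Lemma finite_of_type n m : finite_set [set L | of_type n m L].
Proof.
pose T : finType := (m.-bseq 'I_n.+1 * n.-bseq 'I_n.+1)%type.
pose g (x : T) : seq nat * seq nat := ([seq val i | i <- x.1], [seq val i | i <- x.2]).
apply: (@sub_finite_set _ _ (val @^-1` range g)); last first.
  apply: finite_preimage => [L L' _ _|]; first exact: val_inj.
  by apply: finite_image; exact: finite_finset.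
move=> [[a s] La] /= []; have /and3P[/= _ _ s0] := La.
rewrite /parts /fermionic /bosonic /= => asn am.
have valK l : {subset l <= a ++ s} -> [seq val i | i <- map (@inord n) l] = l.
  move=> las; rewrite -map_comp; apply: map_id_in => i /las /leq_sumn.
  by rewrite asn => i_n /=; rewrite inordK.
have am' : (size (map (@inord n) a) <= m)%N by rewrite size_map am.
have sn' : (size (map (@inord n) s) <= n)%N.
  rewrite size_map (leq_trans (size_leq_sumn s0)) // -asn sumn_cat; exact: leq_addl.
exists (Bseq am', Bseq sn') => //; rewrite /g /= !valK // => i;
  by rewrite mem_cat => ->; rewrite ?orbT.
Qed.

(* The term theta_{s(1)} ... theta_{s(m)} x_{s(1)}^{Lambda_1} x_{s(2)}^{Lambda_2} ...
   (with indices shifted by 1). As only finitely many values of s matter, letting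
   s range over the permutations of nat amounts to letting it range over the S_N
   for all large N. *)
Definition sterm (L : superpartition) (s : nat -> nat) : series nat :=
  monomial (\big[msetD/mset0]_(i < size (parts L)) msetn (nth 0%N (parts L) i) (s i))
           [seq s i | i <- iota 0 (size (fermionic L))].

Definition sterms (L : superpartition) : set (series nat) :=
  [set sterm L s | s in [set s : nat -> nat | bijective s]].

(* The sum of the distinct terms, taken coefficient by coefficient: finitely many
   terms contribute to each coefficient, see [sterms_finite]. *)
Definition msym_series (L : superpartition) : series nat :=
  fun m => \sum_(t \in sterms L) t m.

Lemma sterms_finite L m : finite_set [set t | sterms L t /\ t m != 0].
Proof.
pose g (c : bool) : series nat := fun k => if k == m then (-1) ^+ c else 0.
apply: (@sub_finite_set _ _ (range g)); last first.
  by apply: finite_image; exact: finite_finset.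
move=> _ [[s _ <-]]; rewrite /sterm.
set b := \big[_/_]_(i < _) _; set w := map _ _ => /monomial_neq0[wu mE].
exists (odd (inversions w)) => //; apply/funext => k.
by rewrite /g /monomial wu mE signr_odd.
Qed.

Lemma mset_map0 {d d' : Order.disp_t} {V : orderType d} {W : orderType d'}
    (sigma : V -> W) : mset_map sigma mset0 = mset0.
Proof.
have p0 : perm_eq (mset0 : {mset V}) [::].
  by apply/allP => x _ /=; rewrite count_mem_mset mset0E.
by apply/msetP => w; rewrite mset_seqE (permP (perm_map sigma p0)) mset0E.
Qed.

Lemma mset_map_sterm (s tau : nat -> nat) (a : nat -> nat) n : injective tau ->
  mset_map tau (\big[msetD/mset0]_(i < n) msetn (a i) (s i)) =
  \big[msetD/mset0]_(i < n) msetn (a i) (tau (s i)).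
Proof.
move=> tI; rewrite (big_morph (mset_map tau) (id1 := mset0) (op1 := msetD)).
- apply: eq_bigr => i _; apply/msetP => v.
  have pn : perm_eq (msetn (a i) (s i)) (nseq (a i) (s i)).
    apply/allP => j _; rewrite /= count_mem_mset msetnE count_nseq /=.
    by have [_|_] := eqVneq j (s i); rewrite ?mul1n.
  rewrite mset_seqE (permP (perm_map tau pn)) map_nseq count_nseq msetnE /=.
  by have [_|_] := eqVneq v (tau (s i)); rewrite ?mul1n.
- exact: mset_mapD.
- exact: mset_map0.
Qed.

Lemma subst_sterm L s tau : injective tau ->
  subst tau (sterm L s) = sterm L (tau \o s).
Proof.
by move=> tI; rewrite /sterm subst_monomial // mset_map_sterm // -map_comp.
Qed.

Lemma msym_subproof L : msym_series L \in Lambda_pred.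
Proof.
apply/asboolP; split => [tau taub|]; last first.
  exists (size (\big[msetD/mset0]_(i < size (parts L)) msetn (nth 0%N (parts L) i) (i : nat))
          + size (fermionic L))%N => m.
  move=> /fsum_neq0[_ [s /bij_inj sI <-]] /monomial_neq0[_ ->] /=.
  rewrite /sdeg /= -(@mset_map_sterm (fun i => i) s) // leq_add //.
    by rewrite (perm_size (perm_eq_seq_mset _)) size_map.
  by apply: leq_trans (card_fseq_le _) _; rewrite size_map size_iota.
have tI := bij_inj taub; have [tau' tauK tau'K] := taub.
have termsE : sterms L = (subst tau @` sterms L)%classic.
  apply/seteqP; split => _ [s sb <-].
    exists (sterm L (tau' \o s)).
      by exists (tau' \o s) => //; apply: bij_comp => //; exists tau.
    rewrite subst_sterm //; congr sterm; apply/funext => i /=.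
    by rewrite tau'K.
  case: sb => r rb <-; rewrite subst_sterm //.
  by exists (tau \o r) => //; apply: bij_comp.
apply/funext => m.
case: (pselect (range (smon_map tau) m)) => [[n _ <-]|Hm].
  have E : msym_series L (smon_map tau n) =
           \sum_(t \in sterms L) subst tau t (smon_map tau n).
    rewrite {1}/msym_series {1}termsE.
    by apply: fsbig_image => f g _ _; apply: subst_inj.
  rewrite E substE // mulr_fsumr; apply: eq_fsbigr => t _.
  by rewrite substE.
rewrite subst_out //; apply/esym; rewrite /msym_series termsE.
by apply: fsbig1 => _ [t _ <-]; rewrite subst_out.
Qed.
Definition msym (L : superpartition) : Lambda := MkLambda (msym_subproof L).

Lemma lambda_one_subproof : (sone : series nat) \in Lambda_pred.
Proof.
apply/asboolP; split; last exact: bounded_monomial.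
move=> s sb; rewrite /sone (subst_monomial (bij_inj sb)) /=.
by rewrite (mset_map0 s).
Qed.
Definition lambda_one : Lambda := MkLambda lambda_one_subproof.

Lemma column_subproof (a : seq nat) k : sorted gtn a ->
  is_superpartition (a, nseq k 1%N).
Proof.
move=> sa; rewrite /is_superpartition /= sa mem_nseq andbF andbT /=.
by case: k => //= k; elim: k => //= k ->.
Qed.

(* The superpartitions (emptyset; 1^k) and (0; 1^k). *)
Definition column (k : nat) : superpartition :=
  exist _ ([::], nseq k 1%N) (@column_subproof [::] k isT).
Definition column0 (k : nat) : superpartition :=
  exist _ ([:: 0%N], nseq k 1%N) (@column_subproof [:: 0%N] k isT).

Definition e_ (r : nat) : Lambda := if r is 0 then lambda_one else msym (column r).

Definition et_ (k : nat) : Lambda := msym (column0 k).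

Definition h_ (r : nat) : Lambda :=
  if r is 0 then lambda_one else \sum_(L \in [set L | of_type r 0 L]) msym L.

Definition ht_ (k : nat) : Lambda :=
  \sum_(L \in [set L | of_type k 1 L])
    msym L *+ (head 0%N (fermionic L) + 1)%N.

(* Main.v *)
(* All four series have coefficients of the form [x-degree = k] * w, where the
   weight w of a monomial x^b theta_J does not depend on the names of the
   variables: w = [J = 0] * prod_v [p (b v)] for e and h, and
   w = [J = {u}] * prod_v [p (b v)] * phi (b u) for e~ and h~, with p = (<= 1),
   phi j = [j = 0] in the elementary case and p = true, phi j = j + 1 in the
   complete case. When a monomial is split into its x and y parts, the first kind
   of weight is multiplicative and the second satisfies the Leibniz rule. Signs
   never matter: at most one theta occurs, and the thetas precede the phis. *)
Require Import Defs.
From mathcomp Require Import all_boot all_order all_algebra.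
From mathcomp Require Import finmap multiset.
From mathcomp Require Import boolp classical_sets functions cardinality fsbigop.
Set Implicit Arguments.
Unset Strict Implicit.
Unset Printing Implicit Defensive.
Import Order.TTheory GRing.Theory.
Local Open Scope fset_scope.
Local Open Scope mset_scope.
Local Open Scope ring_scope.

(** * Terms of monomial symmetric functions and shapes of monomials *)

(** Induction from the right: compose with the transposition of [s (size w)] and [x]. Neither is an
    earlier value, so those stay fixed. *)
Lemma extend_bij (w : seq nat) : uniq w ->
  exists2 s : nat -> nat, bijective s & [seq s i | i <- iota 0 (size w)] = w.
Proof.
elim/last_ind: w => [_|w x IH]; first by exists id => //; exists id.
rewrite rcons_uniq => /andP[xw wu]; have [s sb sw] := IH wu.
pose a := s (size w); pose t y := if y == a then x else if y == x then a else y.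
have tK : involutive t.
  move=> y; rewrite /t; case: (eqVneq y a) => [->|ya].
    by rewrite eqxx; case: eqVneq.
  by case: (eqVneq y x) => [->|yx]; rewrite ?eqxx // (negbTE ya) (negbTE yx).
exists (t \o s); first by apply: bij_comp => //; exists t.
rewrite size_rcons -addn1 iotaD map_cat /= cats1 add0n -/a.
have -> : t a = x by rewrite /t eqxx.
congr rcons; rewrite -[RHS]sw; apply/eq_in_map => i; rewrite mem_iota add0n /= => iw.
have siw : s i \in w by rewrite -sw; apply: map_f; rewrite mem_iota.
rewrite /t /a (inj_eq (bij_inj sb)) ltn_eqF //.
by case: eqP => // six; rewrite six (negbTE xw) in siw.
Qed.

Definition exponents (l : seq nat) (s : nat -> nat) : {mset nat} :=
  \big[msetD/mset0]_(i < size l) msetn (nth 0%N l i) (s i).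

(** Distinct indices feed distinct variables; the default 0 of [nth] is the padding by zeros. *)
Lemma exponentsE (l : seq nat) (s : nat -> nat) j : injective s ->
  exponents l s (s j) = nth 0%N l j.
Proof.
move=> sI; rewrite /exponents.
rewrite (big_morph (fun b : {mset nat} => b (s j)) (id1 := 0%N) (op1 := addn));
  [|by move=> b c; rewrite msetE2|by rewrite mset0E].
under eq_bigr do rewrite msetnE (inj_eq sI).
have [jl|lj] := ltnP j (size l); last first.
  rewrite nth_default // big1 // => i _; case: eqP => // ji.
  by move: lj; rewrite ji leqNgt ltn_ord.
rewrite (bigD1 (Ordinal jl)) //= eqxx big1 ?addn0 // => i.
by rewrite -val_eqE /= eq_sym => /negbTE ->.
Qed.

Lemma increasing1 {d : Order.disp_t} {V : orderType d} (x : V) :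
  increasing [fset x] = [:: x].
Proof.
apply: perm_small_eq => //; apply: perm_trans (perm_increasing _) _.
by apply: uniq_perm; rewrite ?fset_uniq // => y; rewrite !inE.
Qed.

Lemma increasing0 {d : Order.disp_t} {V : orderType d} :
  increasing (fset0 : {fset V}) = [::].
Proof.
by apply: perm_small_eq => //; apply: perm_trans (perm_increasing _) _.
Qed.

(* The only superpartition L whose m_L may contain the monomial n, if n has at
   most one theta. *)
Definition shape (n : smon nat) : seq nat * seq nat :=
  ([seq n.1 v | v <- increasing n.2],
   sort geq [seq n.1 v | v <- finsupp n.1 & v \notin n.2]).

Lemma geq_trans : transitive geq.
Proof. by move=> a b c ba ac; apply: leq_trans ac ba. Qed.
Lemma geq_anti : antisymmetric geq.
Proof. by move=> a b; rewrite andbC; apply: anti_leq. Qed.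
Lemma geq_total : total geq.
Proof. by move=> a b; apply: leq_total. Qed.

(** The one monomial that can occur in [sterm L s]. *)
Definition sterm_smon (L : superpartition) (s : nat -> nat) : smon nat :=
  (exponents (parts L) s,
   [fset v in [seq s i | i <- iota 0 (size (fermionic L))]]).

(** With at most one theta, listing the theta variables in increasing order cannot permute the
    fermionic parts; the bosonic parts are the nonzero exponents elsewhere, put back in order by
    sorting. *)
Lemma shape_sterm_smon L s : (size (fermionic L) <= 1)%N -> bijective s ->
  shape (sterm_smon L s) = val L.
Proof.
case: L => [[a l] La] /=; rewrite /fermionic /= => a1 sb; have sI := bij_inj sb.
have [s' sK s'K] := sb.
have /and3P[/= _ lS l0] := La.
rewrite /shape /sterm_smon /parts /fermionic /bosonic /=; congr pair.
  case: a a1 {La} => [|a [|//]] _ /=.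
    by rewrite (_ : [fset _ in _] = fset0) ?increasing0 //; apply/fsetP => x; rewrite !inE.
  rewrite (_ : [fset _ in _] = [fset s 0%N]); last by apply/fsetP => x; rewrite !inE /= ?orbF.
  by by rewrite increasing1 /= exponentsE.
set b := exponents _ _.
rewrite -(sorted_sort geq_trans lS); apply/(perm_sortP geq_total geq_trans geq_anti).
have lE : l = [seq b v | v <- [seq s i | i <- iota (size a) (size l)]].
  rewrite -map_comp (eq_map (_ : _ =1 nth 0%N (a ++ l))); last by move=> i; exact: exponentsE.
  have -> : iota (size a) (size l) = drop (size a) (iota 0 (size (a ++ l))).
    by rewrite drop_iota add0n size_cat addKn.
  by rewrite map_drop map_nth_iota0 // take_size drop_size_cat.
rewrite [X in perm_eq _ X]lE; apply: perm_map; apply: uniq_perm.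
- by rewrite filter_uniq ?fset_uniq.
- by rewrite map_inj_uniq ?iota_uniq.
move=> x; rewrite -[x]s'K (mem_map sI) mem_filter mem_iota !inE (mem_map sI) mem_iota.
rewrite /= add0n -leqNgt mem_finsupp exponentsE // -size_cat.
have [li|il] := leqP (size (a ++ l)) (s' x); first by rewrite nth_default.
have [ai|//] /= := leqP (size a) (s' x).
(* An index in the bosonic range carries a nonzero exponent, since [l] has no zero part. *)
rewrite nth_cat ltnNge ai /=; apply/negP => /eqP e; move/negP: l0; apply.
by rewrite -e mem_nth // ltn_subLR // -size_cat.
Qed.

(** List the theta variables, then the rest of the support by decreasing exponent, and extend this
    list to a permutation of the variables. *)
Lemma shape_sterm_smonP L n : shape n = val L ->
  exists2 s, bijective s & n = sterm_smon L s.
Proof.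
case: n => b J; case: L => [[a l] La] /= [/= aE lE].
pose w2 := sort (relpre b geq) [seq v <- finsupp b | v \notin J].
pose w := increasing J ++ w2.
have mJ x : (x \in increasing J) = (x \in J) by rewrite (perm_mem (perm_increasing J)).
have mw2 x : (x \in w2) = (x \notin J) && (x \in finsupp b).
  by rewrite /w2 mem_sort mem_filter.
have wu : uniq w.
  rewrite cat_uniq (perm_uniq (perm_increasing J)) fset_uniq sort_uniq.
  rewrite filter_uniq ?fset_uniq // andbT.
  by apply/hasPn => x; rewrite mw2 mJ => /andP[].
have [s sb sw] := extend_bij wu; have sI := bij_inj sb; have [s' sK s'K] := sb.
have al : a ++ l = map b w by rewrite map_cat aE -lE sort_map.
exists s => //; rewrite /sterm_smon /parts /fermionic /bosonic /= al; congr pair.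
  apply/msetP => x; rewrite -[x]s'K exponentsE //.
  have [iw|wi] := ltnP (s' x) (size w).
    rewrite (nth_map 0%N) // -[in RHS]sw (nth_map 0%N) ?size_iota //.
    by rewrite nth_iota.
  (* A variable outside [w] has exponent 0, as [w] contains the support of [b]. *)
  rewrite nth_default ?size_map // s'K; apply/eqP; rewrite mset_eq0.
  have : x \notin w.
    rewrite -sw -[x]s'K (mem_map sI) mem_iota add0n /= -leqNgt; exact: wi.
  rewrite mem_cat mJ mw2 negb_or => /andP[-> /=].
  by rewrite msuppE.
apply/fsetP => x; rewrite inE.
have -> : [seq s i | i <- iota 0 (size a)] = increasing J.
  have sa : size a = size (increasing J) by rewrite -aE size_map.
  have := congr1 (take (size a)) sw.
  rewrite -map_take take_iota /w {2}sa take_size_cat // => <-.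
  by rewrite size_cat sa (minn_idPl _) // leq_addr.
by rewrite mJ.
Qed.

(** * Coefficients of monomial symmetric functions with at most one theta *)

Lemma monomial_le1 {d : Order.disp_t} {V : orderType d} (b : {mset V}) (w : seq V) n :
  (size w <= 1)%N -> monomial b w n = (n == (b, [fset v in w]))%:R.
Proof.
rewrite /monomial; case: w => [|x [|//]] _ /=; rewrite ?addn0 expr0;
  by case: eqP.
Qed.

(** Each term is a single monomial with coefficient 1. Permutations leading to the same monomial
    give equal series, so the sum of distinct terms counts it once. *)
Lemma msymE L n : (size (fermionic L) <= 1)%N ->
  lseries (msym L) n = (shape n == val L)%:R.
Proof.
move=> L1.
have sE s k : sterm L s k = (k == sterm_smon L s)%:R.
  by rewrite /sterm monomial_le1 // size_map size_iota.
rewrite -[LHS]/(msym_series L n) /msym_series; have [nL|nL] := eqVneq.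
  have [s sb nE] := shape_sterm_smonP nL.
  rewrite -(@fsbig_widen _ _ _ _ [set (sterm L s)]); first by rewrite fsbig_set1 sE nE eqxx.
    by move=> _ ->; exists s.
  move=> _ [[s' _ <-] /= s's]; rewrite sE; case: eqP => // nE'; case: s's.
  by apply/funext => k; rewrite !sE -nE -nE'.
apply: fsbig1 => _ [s sb <-]; rewrite sE; case: eqP => // nE.
by case/eqP: nL; rewrite nE shape_sterm_smon.
Qed.

(** * Degree and type of a shape *)

Lemma size_sum_mset (V : choiceType) (b : {mset V}) :
  size b = sumn [seq b v | v <- finsupp b].
Proof. by rewrite size_mset sumn_map. Qed.

Lemma sumn_finsupp (n : smon nat) :
  sumn [seq n.1 v | v <- finsupp n.1] =
  sumn ([seq n.1 v | v <- increasing n.2] ++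
        [seq n.1 v | v <- finsupp n.1 & v \notin n.2]).
Proof.
rewrite sumn_cat !sumn_map big_filter (perm_big _ (perm_increasing _)) /=.
rewrite (bigID (mem n.2)) /=; congr addn.
(* Theta variables outside the support have exponent 0 and add nothing. *)
rewrite [RHS](bigID (mem (finsupp n.1))) /= [X in (_ + X)%N]big1 ?addn0; last first.
  by move=> v; rewrite mem_finsupp negbK => /eqP.
rewrite -[LHS]big_filter -[RHS]big_filter; apply: perm_big; apply: uniq_perm;
  rewrite ?filter_uniq ?fset_uniq // => v; by rewrite !mem_filter andbC.
Qed.

Lemma sumn_shape n : sumn ((shape n).1 ++ (shape n).2) = size n.1.
Proof.
rewrite size_sum_mset sumn_finsupp !sumn_cat; congr addn.
by apply: perm_sumn; rewrite perm_sort.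
Qed.

Lemma size_shape1 n : size (shape n).1 = #|` n.2|.
Proof. by rewrite size_map size_increasing. Qed.

Lemma shape_superpartition n : (#|` n.2| <= 1)%N -> is_superpartition (shape n).
Proof.
rewrite -size_shape1 /is_superpartition => n1; apply/and3P; split.
- by case: (shape n).1 n1 => [|? []].
- by apply: sort_sorted geq_total _.
rewrite mem_sort; apply/mapP => -[v]; rewrite mem_filter => /andP[_].
by rewrite mem_finsupp => /negbTE/eqP v0 e; rewrite -e in v0.
Qed.

(** The theta variables lie outside the support, so the bosonic part lists all nonzero exponents. If
    these are all 1, their number is the x-degree. *)
Lemma shape_column (n : smon nat) k : (forall v, v \in n.2 -> n.1 v = 0%N) ->
  ((shape n).2 == nseq k 1%N) =
  (size n.1 == k) && `[< forall v, (n.1 v <= 1)%N >].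
Proof.
move=> n0; rewrite /shape /=.
have -> : [seq v <- finsupp n.1 | v \notin n.2] = finsupp n.1.
  apply/all_filterP/allP => v; rewrite mem_finsupp; apply: contra => /n0 ->.
  exact: eqxx.
apply/eqP/andP => [e|[/eqP nk /asboolP n1]].
  have p : perm_eq [seq n.1 v | v <- finsupp n.1] (nseq k 1%N).
    by rewrite -e perm_sym perm_sort.
  rewrite size_sum_mset (perm_sumn p) sumn_nseq mul1n; split=> //.
  apply/asboolP => v; have [vn|] := boolP (v \in finsupp n.1); last first.
    by rewrite mem_finsupp negbK => /eqP ->.
  have : n.1 v \in nseq k 1%N by rewrite -(perm_mem p) map_f.
  by rewrite mem_nseq => /andP[_ /eqP ->].
have e : [seq n.1 v | v <- finsupp n.1] = nseq k 1%N.
  have /all_pred1P a1 : all (pred1 1%N) [seq n.1 v | v <- finsupp n.1].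
    apply/allP => _ /mapP[v + ->]; rewrite mem_finsupp /= => v0.
    by rewrite eqn_leq n1 lt0n.
  have <- : size [seq n.1 v | v <- finsupp n.1] = k; last exact: a1.
  by rewrite -nk size_sum_mset [in RHS]a1 sumn_nseq mul1n.
rewrite e; apply/(sorted_sort geq_trans); elim: k {nk e} => //= k.
by case: k => //= k ->.
Qed.

(** * Weights and the coefficients of the four families *)

Section Weights.
Variables (p : pred nat) (phi : nat -> rat).

Definition wbos {V : choiceType} (n : smon V) : rat :=
  ((#|` n.2| == 0%N) && `[< forall v, p (n.1 v) >])%:R.

(** The sum has one term whenever the indicator is 1; its form avoids choosing the theta variable
    and splits over a union. *)
Definition wferm {V : choiceType} (n : smon V) : rat :=
  ((#|` n.2| == 1%N) && `[< forall v, p (n.1 v) >])%:R *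
  \sum_(v <- n.2) phi (n.1 v).

End Weights.

Lemma e_coef k n :
  lseries (e_ k) n = (size n.1 == k)%:R * wbos (leq^~ 1%N) n.
Proof.
rewrite /wbos; case: k => [|k].
  rewrite /= [LHS]/(sone n) monomial_le1 // -natrM mulnb; congr (_ %:R); congr nat_of_bool.
  case: n => b J /=; rewrite size_mset_eq0 cardfs_eq0 xpair_eqE.
  have -> : [fset v in [::]] = fset0 :> {fset nat} by apply/fsetP => v; rewrite !inE.
  have [->|//] := eqVneq b mset0; rewrite /= andbC.
  by rewrite (introT (asboolP _)) // => v; rewrite mset0E.
rewrite [e_ _]/= msymE // -natrM mulnb; congr (_ %:R); congr nat_of_bool.
rewrite [shape n]surjective_pairing xpair_eqE -size_eq0 size_shape1.
have [n0|//] := eqVneq #|` n.2| 0%N; last by rewrite andbF.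
rewrite shape_column // => v; move/eqP: n0; rewrite cardfs_eq0 => /eqP ->.
by rewrite inE.
Qed.

(** The fermionic part 0 of [column0 k] forces exponent 0 at the theta variable: this is the factor
    [phi], and also the hypothesis of [shape_column]. *)
Lemma et_coef k n : lseries (et_ k) n =
  (size n.1 == k)%:R * wferm (leq^~ 1%N) (fun j => (j == 0%N)%:R) n.
Proof.
rewrite /wferm /et_ msymE // [shape n]surjective_pairing xpair_eqE.
have [n1|n1] := eqVneq #|` n.2| 1%N; last first.
  rewrite mul0r mulr0; have [e|//] := eqVneq (shape n).1 [:: 0%N].
  by move: n1; rewrite -size_shape1 e.
have /cardfs1P[x nx] : #|` n.2| == 1%N by rewrite n1.
rewrite nx big_seq_fset1 -!natrM !mulnb; congr (_ %:R); congr nat_of_bool.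
rewrite {1}/shape nx increasing1 /= eqseq_cons andbT andbA andbC.
have [x0|_] := eqVneq (n.1 x) 0%N; rewrite ?andbF // andbT.
rewrite /= andbT shape_column // => v; rewrite nx inE => /eqP ->; exact: x0.
Qed.

(** The multiplicity [c] lets one computation serve [h_] (constant 1) and [ht_] (fermionic part plus
    one). *)
Lemma msym_sumE (A : set superpartition) (c : superpartition -> nat) n :
  finite_set A -> (forall L, A L -> (size (fermionic L) <= 1)%N) ->
  lseries (\sum_(L \in A) msym L *+ c L) n =
  \sum_(L \in A) ((shape n == val L)%:R : rat) *+ c L.
Proof.
move=> fA A1; rewrite [X in lseries X]fsbig_finite // [RHS]fsbig_finite //=.
rewrite (big_morph (fun f : Lambda => lseries f n) (id1 := 0) (op1 := +%R)) //.
rewrite [LHS]big_seq [RHS]big_seq; apply: eq_bigr => L; rewrite in_fset_set // inE => /A1 L1.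
rewrite -msymE //; by elim: (c L) => // j IH; rewrite !mulrS -IH.
Qed.

Lemma msym_sum_type k j (c : superpartition -> nat) n : (j <= 1)%N ->
  lseries (\sum_(L \in [set L | of_type k j L]) msym L *+ c L) n =
  \sum_(L \in [set L | of_type k j L]) ((shape n == val L)%:R : rat) *+ c L.
Proof.
move=> j1; apply: msym_sumE; first exact: finite_of_type.
by move=> L [_ ->].
Qed.

(** Only [L] equal to the shape of [n] contributes; the bound on [j] makes that shape a
    superpartition. *)
Lemma sum_shape k j (c : seq nat -> nat) n : (j <= 1)%N ->
  \sum_(L \in [set L | of_type k j L]) ((shape n == val L)%:R : rat) *+ c (fermionic L) =
  ((size n.1 == k) && (#|` n.2| == j))%:R *+ c (shape n).1.
Proof.
move=> j1; case: (boolP (_ && _)) => [/andP[/eqP nk /eqP nj]|H].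
  have sp : is_superpartition (shape n) by apply: shape_superpartition; rewrite nj.
  pose L0 : superpartition := exist (fun L : seq nat * seq nat => is_superpartition L) _ sp.
  rewrite -(@fsbig_widen _ _ _ _ [set L0]).
  - by rewrite fsbig_set1 /= eqxx.
  - by move=> _ ->; split; rewrite ?sumn_shape // size_shape1.
  - move=> L [_ /= Ln]; case: eqP => [e|]; last by rewrite mul0rn.
    by case: Ln; apply: val_inj.
rewrite mul0rn; apply: fsbig1 => L [Lk Lj]; case: eqP => [e|]; last by rewrite mul0rn.
by case/negP: H; rewrite -sumn_shape -size_shape1 e -[_.1]/(fermionic L) Lj -Lk !eqxx.
Qed.

Lemma h_coef k n : lseries (h_ k) n = (size n.1 == k)%:R * wbos xpredT n.
Proof.
rewrite /wbos (introT (asboolP _)) // andbT -natrM mulnb; case: k => [|k].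
  rewrite /= [LHS]/(sone n) monomial_le1 //; congr (_ %:R); congr nat_of_bool.
  case: n => b J /=; rewrite size_mset_eq0 cardfs_eq0 xpair_eqE.
  by have -> : [fset v in [::]] = fset0 :> {fset nat} by apply/fsetP => v; rewrite !inE.
rewrite [h_ _]/= -[RHS](@sum_shape k.+1 0 (fun=> 1%N) n) //.
by rewrite -(@msym_sum_type k.+1 0 (fun=> 1%N) n).
Qed.

Lemma ht_coef k n : lseries (ht_ k) n =
  (size n.1 == k)%:R * wferm xpredT (fun j => j.+1%:R) n.
Proof.
rewrite /wferm (introT (asboolP _)) // andbT mulrA -natrM mulnb.
rewrite /ht_ (msym_sum_type k (fun L => head 0%N (fermionic L) + 1)%N) //.
rewrite (@sum_shape k 1 (fun l => head 0%N l + 1)%N) //.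
have [|] := boolP (_ && _); last by rewrite mul0r mul0rn.
case/andP=> _ /cardfs1P[x nx]; rewrite mul1r /shape nx increasing1 big_seq_fset1 /=.
by rewrite addn1.
Qed.

(** * Invariance of the weights under renaming variables, and coefficients of the coproduct *)

Section Transport.
Context {d d' : Order.disp_t} {V : orderType d} {W : orderType d'}.
Variables (p : pred nat) (phi : nat -> rat) (sigma : V -> W).

Lemma size_mset_map (b : {mset V}) : size (mset_map sigma b) = size b.
Proof. by rewrite (perm_size (perm_eq_seq_mset _)) size_map. Qed.

Hypothesis sigma_bij : bijective sigma.

Lemma asbool_forall_map (b : {mset V}) :
  `[< forall w, p (mset_map sigma b w) >] = `[< forall v, p (b v) >].
Proof.
have sI := bij_inj sigma_bij; have [tau sK tauK] := sigma_bij.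
apply: asbool_equiv_eq; split=> H v.
  by rewrite -(mset_mapE sI).
by rewrite -[v]tauK mset_mapE.
Qed.

Lemma card_smon_map (n : smon V) : #|` (smon_map sigma n).2| = #|` n.2|.
Proof. by rewrite card_imfset //; exact: bij_inj. Qed.

Lemma wbos_map (n : smon V) : wbos p (smon_map sigma n) = wbos p n.
Proof. by rewrite /wbos card_smon_map asbool_forall_map. Qed.

Lemma wferm_map (n : smon V) : wferm p phi (smon_map sigma n) = wferm p phi n.
Proof.
rewrite /wferm card_smon_map asbool_forall_map; congr (_ * _).
have sI := bij_inj sigma_bij.
have pJ : perm_eq (smon_map sigma n).2 (map sigma n.2).
  apply: uniq_perm; rewrite ?fset_uniq ?map_inj_uniq ?fset_uniq // => w.
  by apply/imfsetP/mapP => -[v vn ->]; exists v.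
rewrite (perm_big _ pJ) big_map; apply: eq_bigr => v _.
by rewrite mset_mapE.
Qed.

End Transport.

Lemma wbos_le1 p (V : choiceType) (n : smon V) : wbos p n != 0 -> (#|` n.2| <= 1)%N.
Proof. by rewrite /wbos; have [->|] := eqVneq #|` n.2| 0%N; rewrite ?eqxx. Qed.

Lemma wferm_le1 p phi (V : choiceType) (n : smon V) :
  wferm p phi n != 0 -> (#|` n.2| <= 1)%N.
Proof. by rewrite /wferm; have [->|] := eqVneq #|` n.2| 1%N; rewrite ?mul0r ?eqxx. Qed.

(** Interleaving is bijective, so every monomial in the two alphabets is a renamed [n]. A nonzero
    weight allows at most one theta, hence no sign. The weight is polymorphic because it is read in
    both sets of variables. *)
Lemma Delta_coef (f : Lambda) (w : forall V : choiceType, smon V -> rat) k :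
  (forall n, lseries f n = (size n.1 == k)%:R * w _ n) ->
  (forall n, w (var2 : choiceType) (smon_map interleave n) = w _ n) ->
  (forall n : smon nat, w _ n != 0 -> (#|` n.2| <= 1)%N) ->
  forall m, lseries2 (Delta f) m = (size m.1 == k)%:R * w _ m.
Proof.
move=> fE wmap w1 m; have [u uK Ku] := interleave_bij; have iI := bij_inj interleave_bij.
have mE : m = smon_map interleave (smon_map u m).
  case: m => b J; congr pair.
    apply/msetP => x; rewrite -[x]Ku mset_mapE // -[u x]uK Ku.
    by rewrite mset_mapE //; exact: can_inj Ku.
  rewrite -imfset_comp; apply/fsetP => x; apply/idP/imfsetP => /=.
    by move=> xJ; exists x => //=; rewrite Ku.
  by move=> [y yJ ->]; rewrite /= Ku.
rewrite mE; move: (smon_map u m) => n {m mE}.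
rewrite -[LHS]/(subst interleave f (smon_map interleave n)) substE // fE wmap size_mset_map.
have [->|/w1 n1] := eqVneq (w _ n) 0; first by rewrite !mulr0.
rewrite /smon_sgn; move: n1; rewrite -size_increasing.
by case: (increasing n.2) => [|x [|//]] _; rewrite /sgn /= ?addn0 expr0 mul1r.
Qed.

(** * Splitting a monomial into its two alphabets *)

(* The part of m in the alphabet x, theta (c = false) or y, phi (c = true). *)
Definition half (c : bool) (m : smon var2) : smon nat :=
  (seq_mset [seq v.2 | v <- m.1 & v.1 == c], [fset v.2 | v in m.2 & v.1 == c]).

Lemma smonP (V : choiceType) (n n' : smon V) :
  n.1 =1 n'.1 -> n.2 =i n'.2 -> n = n'.
Proof. by case: n n' => b J [c K] /= /msetP -> /fsetP ->. Qed.

Lemma half_mset c m i : (half c m).1 i = m.1 (c, i).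
Proof.
rewrite mset_seqE count_map count_filter -count_mem_mset; apply: eq_count => -[x y] /=.
by rewrite xpair_eqE andbC.
Qed.

Lemma half_fset c m i : (i \in (half c m).2) = ((c, i) \in m.2).
Proof.
apply/imfsetP/idP => [[[x y] /=]|cm].
  by rewrite inE /= => /andP[xm /eqP <-] ->.
by exists (c, i); rewrite //= inE /= cm eqxx.
Qed.

Lemma perm_halves_mset (m : smon var2) : perm_eq m.1
  ([seq varx i | i <- (half false m).1] ++ [seq vary i | i <- (half true m).1]).
Proof.
have E (c c' : bool) (i : nat) (s : seq nat) :
    count (fun k => (c', k) == (c, i)) s = (if c == c' then count_mem i s else 0)%N.
  case: eqP => [->|cc']; first by apply: eq_count => k; rewrite xpair_eqE eqxx.
  by rewrite -[RHS](count_pred0 s); apply: eq_count => k; apply/eqP => -[/esym].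
apply/allP => -[c i] _; apply/eqP; rewrite count_cat !count_map count_mem_mset -half_mset.
rewrite -count_mem_mset; transitivity
  ((if c == false then count_mem i (half false m).1 else 0) +
   (if c == true then count_mem i (half true m).1 else 0))%N.
  by case: c; rewrite ?addn0.
by congr addn; apply/esym/E.
Qed.

Lemma perm_halves_fset (m : smon var2) : perm_eq m.2
  ([seq varx i | i <- (half false m).2] ++ [seq vary i | i <- (half true m).2]).
Proof.
apply: uniq_perm; first exact: fset_uniq.
  rewrite cat_uniq !map_inj_uniq ?fset_uniq ?andbT; try exact: varx_inj; try exact: vary_inj.
  by apply/hasPn => _ /mapP[i _ ->]; apply/mapP => -[].
move=> [c i]; rewrite mem_cat; case: c.
  rewrite -half_fset [X in X || _](_ : _ = false) ?(mem_map vary_inj) //.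
  by apply/negP => /mapP[].
rewrite -half_fset orbC [X in X || _](_ : _ = false) ?(mem_map varx_inj) //.
by apply/negP => /mapP[].
Qed.

Lemma size_halves (m : smon var2) :
  size m.1 = (size (half false m).1 + size (half true m).1)%N.
Proof. by rewrite (perm_size (perm_halves_mset m)) size_cat !size_map. Qed.

Lemma card_halves (m : smon var2) :
  #|` m.2| = (#|` (half false m).2| + #|` (half true m).2|)%N.
Proof. by rewrite (perm_size (perm_halves_fset m)) size_cat !size_map. Qed.

Lemma asbool_halves (p : pred nat) (m : smon var2) :
  `[< forall v, p (m.1 v) >] =
  `[< forall i, p ((half false m).1 i) >] && `[< forall i, p ((half true m).1 i) >].
Proof.
rewrite -asbool_and; apply: asbool_equiv_eq; split=> [H|[H0 H1] [[] i]].
- by split=> i; rewrite half_mset.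
- by rewrite -half_mset.
- by rewrite -half_mset.
Qed.

Lemma wbos_halves p m : wbos p m = wbos p (half false m) * wbos p (half true m).
Proof.
by rewrite /wbos -natrM mulnb card_halves asbool_halves addn_eq0 andbACA.
Qed.

(** A single theta lies in exactly one half: one summand for each possibility. *)
Lemma wferm_halves p phi m : wferm p phi m =
  wferm p phi (half false m) * wbos p (half true m) +
  wbos p (half false m) * wferm p phi (half true m).
Proof.
rewrite /wferm /wbos card_halves asbool_halves.
rewrite (perm_big _ (perm_halves_fset m)) big_cat !big_map /=.
under eq_bigr do rewrite -half_mset.
under [X in _ * (_ + X)]eq_bigr do rewrite -half_mset.
move: `[< _ >] `[< _ >] => P0 P1.
have S0 c : #|` (half c m).2| = 0%N ->
    \sum_(i <- (half c m).2) phi ((half c m).1 i) = 0.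
  by move/eqP; rewrite cardfs_eq0 => /eqP ->; rewrite big_nil.
have := S0 false; have := S0 true.
(* Each half has 0, 1 or more thetas; two or more in total make both sides vanish. *)
case: #|` (half false m).2| => [|[|a]]; case: #|` (half true m).2| => [|[|c]] /= S1 S2;
  rewrite ?(S1 erefl) ?(S2 erefl);
  by case: P0; case: P1; rewrite /= ?(mulr0n, mulr1n, mul0r, mulr0, addr0, add0r, mul1r, mulr1).
Qed.

(** * Coefficients of a tensor product *)

Lemma inversions_map {d d' : Order.disp_t} {V : orderType d} {W : orderType d'}
    (g : V -> W) w : {mono g : x y / (x < y)%O} ->
  inversions (map g w) = inversions w.
Proof.
move=> gm; elim: w => //= v w ->; congr addn; rewrite count_map.
by apply: eq_count => u /=; rewrite gm.
Qed.

Lemma varx_lt : {mono varx : i j / (i < j)%O}.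
Proof. by move=> i j; rewrite /varx ltxi_pair. Qed.
Lemma vary_lt : {mono vary : i j / (i < j)%O}.
Proof. by move=> i j; rewrite /vary ltxi_pair. Qed.

Lemma smon_sgn_mono {d d' : Order.disp_t} {V : orderType d} {W : orderType d'}
    (g : V -> W) n : {mono g : x y / (x < y)%O} -> smon_sgn g n = 1.
Proof. by move=> gm; rewrite /smon_sgn /sgn inversions_map // inversions_increasing. Qed.

(** Only the embedded halves of [m] multiply to [m], and with sign 1: both embeddings are monotone
    and every theta precedes every phi. *)
Lemma tensor_coef (f g : Lambda) m :
  lseries2 (tensor f g) m = lseries f (half false m) * lseries g (half true m).
Proof.
rewrite -[LHS]/(smul (subst varx f) (subst vary g) m) /smul.
set p := smon_map varx (half false m); set q := smon_map vary (half true m).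
rewrite -(@fsbig_widen _ _ _ _ [set (p, q)]) //.
  rewrite fsbig_set1 /= !substE ?smon_sgn_mono ?mul1r //;
    try exact: varx_inj; try exact: vary_inj; try exact: varx_lt; try exact: vary_lt.
  rewrite [X in _ * X](_ : _ = 1) ?mulr1 // /monomial.
  have pw : perm_eq (increasing p.2 ++ increasing q.2) m.2.
    rewrite perm_sym (permPl (perm_halves_fset m)) perm_sym; apply: perm_cat.
      apply: perm_trans (perm_increasing_map varx_inj _) _.
      by apply: perm_map; exact: perm_increasing.
    apply: perm_trans (perm_increasing_map vary_inj _) _.
    by apply: perm_map; exact: perm_increasing.
  rewrite (perm_uniq pw) fset_uniq /= ifT; last first.
    apply/eqP; case: m @p @q pw => b J p q pw; congr pair; last first.
      by apply/fsetP => v; rewrite in_fseq (perm_mem pw).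
    apply/msetP => v; have := permP (perm_halves_mset (b, J)) (pred1 v).
    by rewrite count_cat msetE2 !mset_seqE count_mem_mset.
  (* Inversions between the two words would need a phi smaller than a theta. *)
  rewrite inversions_cat !inversions_increasing big_seq big1 ?expr0 // => v.
  rewrite (perm_mem (perm_increasing _)) => /imfsetP[/= i _ ->].
  apply/eqP; rewrite eqn0Ngt -has_count; apply/hasPn => u.
  by rewrite (perm_mem (perm_increasing _)) => /imfsetP[/= k _ ->].
move=> [p' q'] [_ /= npq].
case: (pselect (range (smon_map varx) p')) => [[a _ aE]|Hp]; last first.
  by rewrite (subst_out _ Hp) !mul0r.
case: (pselect (range (smon_map vary) q')) => [[c _ cE]|Hq]; last first.
  by rewrite (subst_out _ Hq) mulr0 mul0r.
(* If the embedded [a] and [c] multiply to [m], they are its halves, against [npq]. *)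
apply/eqP; rewrite mulf_eq0; apply/orP; right; apply/negPn/negP.
move=> /monomial_neq0[_ mE]; apply: npq; rewrite /p /q -aE -cE.
suff [-> ->] : a = half false m /\ c = half true m by [].
have mset_map0 (e : smon nat) i :
    (mset_map varx e.1 (vary i) = 0%N) * (mset_map vary e.1 (varx i) = 0%N).
  split; apply/eqP; rewrite mset_eq0 (perm_mem (perm_eq_seq_mset _)); by apply/mapP; case.
rewrite mE -aE -cE; split; apply: smonP => i.
- by rewrite half_mset /= msetE2 mset_map0 addn0 (mset_mapE varx_inj).
- rewrite half_fset /= (@in_fseq _ var2) mem_cat !(perm_mem (perm_increasing _)).
  by rewrite (mem_imfset _ _ varx_inj) /=; case: imfsetP => [[]//|_]; rewrite orbF.
- by rewrite half_mset /= msetE2 mset_map0 add0n (mset_mapE vary_inj).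
rewrite half_fset /= (@in_fseq _ var2) mem_cat !(perm_mem (perm_increasing _)).
by rewrite orbC (mem_imfset _ _ vary_inj) /=; case: imfsetP => [[]//|_]; rewrite orbF.
Qed.

(** * Comparison of coefficients in the coproduct formulas *)

(** The indicators leave only the pair [(x, y)], which is in the index set exactly when its sum is
    [i]. *)
Lemma sum_degrees (i x y : nat) (A B : rat) :
  \sum_(p : 'I_i.+1 * 'I_i.+1 | (p.1 + p.2 == i)%N)
    (x == p.1)%:R * A * ((y == p.2)%:R * B) = ((x + y)%N == i)%:R * (A * B).
Proof.
have [xyi|nxy] := eqVneq (x + y)%N i; last first.
  rewrite mul0r big1 // => -[a c] /= /eqP aci; case: eqP => [xa|]; last by rewrite !mul0r.
  case: eqP => [yc|]; last by rewrite mul0r mulr0.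
  by case/eqP: nxy; rewrite xa yc.
have xi : (x < i.+1)%N by rewrite ltnS -xyi leq_addr.
have yi : (y < i.+1)%N by rewrite ltnS -xyi leq_addl.
rewrite (bigD1 (Ordinal xi, Ordinal yi)) /= ?xyi // !eqxx !mul1r.
rewrite big1 ?addr0 // => -[a c] /= /andP[_]; rewrite xpair_eqE -!val_eqE /=.
rewrite [val a == x]eq_sym [val c == y]eq_sym => /negbTE nac.
by rewrite mulrACA -natrM mulnb nac mul0r.
Qed.

Lemma lseries2_sum (I : Type) (r : seq I) (P : pred I) (F : I -> Lambda2) m :
  lseries2 (\sum_(i <- r | P i) F i) m = \sum_(i <- r | P i) lseries2 (F i) m.
Proof. by rewrite (big_morph (fun f => lseries2 f m) (id1 := 0) (op1 := +%R)). Qed.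

Lemma Lambda2P (F G : Lambda2) : (forall m, lseries2 F m = lseries2 G m) -> F = G.
Proof. by move=> FG; apply: val_inj; apply/funext. Qed.

(** [sum_degrees] collapses the right side to the degrees of the halves; multiplicativity of [wbos]
    does the rest. *)
Lemma Delta_bos p (F : nat -> Lambda) i :
  (forall k n, lseries (F k) n = (size n.1 == k)%:R * wbos p n) ->
  Delta (F i) =
  \sum_(q : 'I_i.+1 * 'I_i.+1 | (q.1 + q.2 == i)%N) tensor (F q.1) (F q.2).
Proof.
move=> FE; apply: Lambda2P => m; rewrite lseries2_sum.
under eq_bigr do rewrite tensor_coef !FE.
rewrite sum_degrees -wbos_halves -size_halves.
apply: (@Delta_coef _ (@wbos p) i) => [n|n|n]; first exact: FE.
  exact: wbos_map interleave_bij n.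
exact: wbos_le1.
Qed.

Lemma Delta_ferm p phi (F T : nat -> Lambda) i :
  (forall k n, lseries (F k) n = (size n.1 == k)%:R * wbos p n) ->
  (forall k n, lseries (T k) n = (size n.1 == k)%:R * wferm p phi n) ->
  Delta (T i) =
  \sum_(q : 'I_i.+1 * 'I_i.+1 | (q.1 + q.2 == i)%N)
    (tensor (T q.1) (F q.2) + tensor (F q.2) (T q.1)).
Proof.
move=> FE TE; apply: Lambda2P => m; rewrite big_split /=.
rewrite -[RHS]/(lseries2 (\sum_(q | _) _) m + lseries2 (\sum_(q | _) _) m) !lseries2_sum.
under eq_bigr do rewrite tensor_coef FE TE.
(* Here [q.1] is the degree of the y half, so the factors are swapped to fit [sum_degrees]. *)
under [X in _ + X]eq_bigr do rewrite tensor_coef FE TE mulrC.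
rewrite !sum_degrees [(size _ + size (half false m).1)%N]addnC -size_halves.
rewrite -mulrDr [wferm p phi (half true m) * _]mulrC -wferm_halves.
apply: (@Delta_coef _ (@wferm p phi) i) => [n|n|n]; first exact: TE.
  exact: wferm_map interleave_bij n.
exact: wferm_le1.
Qed.

Theorem proposition4p1 :
  (forall i : nat, (1 <= i)%N ->
     Delta (e_ i) =
     \sum_(p : 'I_i.+1 * 'I_i.+1 | (p.1 + p.2 == i)%N) tensor (e_ p.1) (e_ p.2)) /\
  (forall i : nat,
     Delta (et_ i) =
     \sum_(p : 'I_i.+1 * 'I_i.+1 | (p.1 + p.2 == i)%N)
        (tensor (et_ p.1) (e_ p.2) + tensor (e_ p.2) (et_ p.1))) /\
  (forall i : nat, (1 <= i)%N ->
     Delta (h_ i) =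
     \sum_(p : 'I_i.+1 * 'I_i.+1 | (p.1 + p.2 == i)%N) tensor (h_ p.1) (h_ p.2)) /\
  (forall i : nat,
     Delta (ht_ i) =
     \sum_(p : 'I_i.+1 * 'I_i.+1 | (p.1 + p.2 == i)%N)
        (tensor (ht_ p.1) (h_ p.2) + tensor (h_ p.2) (ht_ p.1))).
Proof.
split; first by move=> i _; apply: Delta_bos e_coef.
split; first by move=> i; apply: Delta_ferm e_coef et_coef.
split; first by move=> i _; apply: Delta_bos h_coef.
by move=> i; apply: Delta_ferm h_coef ht_coef.
Qed.
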